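(* Let $m\in\mathbb N$. The number $\pi(6m+1)$ of prime numbers not exceeding $6m+1$, except $2$ and $3$, equals $$\pi(6m+1)=\pi^{(+)}(6m+1)+\pi^{(-)}(6m-1)=2m-\left(P^{(+)}(6m+1)+P^{(-)}(6m-1)\right),$$ where $\pi^{(+)}(6m+1)$ is the number of primes of the form $6\tau+1$ ($\tau\in\mathbb N$) not exceeding $6m+1$, $\pi^{(-)}(6m-1)$ is the number of primes of the form $6\tau-1$ ($\tau\in\mathbb N$) not exceeding $6m-1$, and $P^{(+)}(6m+1)$, $P^{(-)}(6m-1)$ are given by the explicit formulas in the context.
   Context: $\mathbb N=\{1,2,3,\dots\}$ and $[x]$ denotes the integer part (floor) of $x$. Empty sums are $0$. Here $\pi(6m+1)$ does not count the primes $2$ and $3$. For nonnegative integers $a,b$, let $K_1^{a}(-)$ be the set of prime numbers of the form $6i-1$ with $1\le i\le a$, and $K_1^{b}(+)$ the set of prime numbers of the form $6j+1$ with $1\le j\le b$. For $q\ge2$ let $K_q^{a,b}(-)$ (respectively $K_q^{a,b}(+)$) be the set of all numbers that are of the form $6\tau-1$ (respectively $6\tau+1$), $\tau\in\mathbb N$, and are products of $q$ pairwise distinct elements of $K_1^{a}(-)\cup K_1^{b}(+)$. With $\nu=\left[\frac{1+\sqrt{6m+1}}{6}\right]$ and $k=\left[\frac{-1+\sqrt{6m+1}}{6}\right]$, $$P^{(+)}(6m+1)=\sum_{K\in K_1^{\nu}(-)}\left[\frac{6m+K+1}{6K}\right]+\sum_{K\in K_1^{k}(+)}\left[\frac{6m-K+1}{6K}\right]+\sum_{q=2}^{\nu+k}(-1)^{q-1}\left(\sum_{K\in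 K_q^{\nu,k}(-)}\left[\frac{6m+K+1}{6K}\right]+\sum_{K\in K_q^{\nu,k}(+)}\left[\frac{6m+5K+1}{6K}\right]\right).$$ With $r=\left[\frac{\sqrt{6m}}{6}\right]$, $$P^{(-)}(6m-1)=\sum_{K\in K_1^{r}(-)}\left[\frac{6m-K-1}{6K}\right]+\sum_{K\in K_1^{r}(+)}\left[\frac{6m+K-1}{6K}\right]+\sum_{q=2}^{2r}(-1)^{q-1}\left(\sum_{K\in K_q^{r,r}(-)}\left[\frac{6m+5K+1}{6K}\right]+\sum_{K\in K_q^{r,r}(+)}\left[\frac{6m+K-1}{6K}\right]\right).$$ In the paper $P^{(+)}(6m+1)$ denotes the number of composite numbers of the form $6\tau+1$ ($\tau\in\mathbb N$) not exceeding $6m+1$, and $P^{(-)}(6m-1)$ the number of composite numbers of the form $6\tau-1$ ($\tau\in\mathbb N$) not exceeding $6m-1$; the formulas above are the values the paper gives for them. *)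

(* Defs.v *)
From HB Require Import structures.
From mathcomp Require Import all_boot all_order all_algebra.
From mathcomp Require Import finmap.
From mathcomp Require Import boolp reals.
Set Implicit Arguments.
Unset Strict Implicit.
Unset Printing Implicit Defensive.
Import Order.TTheory GRing.Theory Num.Theory.

Local Open Scope ring_scope.

Definition form_minus (n : nat) : Prop :=
  exists2 tau : nat, (0 < tau)%N & n = (6 * tau - 1)%N.

Definition form_plus (n : nat) : Prop :=
  exists2 tau : nat, (0 < tau)%N & n = (6 * tau + 1)%N.

(* The primes 2 and 3 are not counted. *)
Definition prime_pi (x : nat) : nat :=
  #|[set p : 'I_x.+1 | [&& prime p, p != 2 :> nat & p != 3 :> nat]]|.

Definition prime_pi_plus (x : nat) : nat :=
  #|[set p : 'I_x.+1 | prime p & `[< form_plus p >]]|.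

Definition prime_pi_minus (x : nat) : nat :=
  #|[set p : 'I_x.+1 | prime p & `[< form_minus p >]]|.

Definition K1_minus (a : nat) : {fset nat} :=
  [fset p in [seq (6 * i - 1)%N | i <- iota 1 a] | prime p]%fset.

Definition K1_plus (b : nat) : {fset nat} :=
  [fset p in [seq (6 * j + 1)%N | j <- iota 1 b] | prime p]%fset.

Definition K_products (q a b : nat) : {fset nat} :=
  [fset (\prod_(p <- enum_fset S) p)%N
     | S : {fset nat} in [fset S in fpowerset (K1_minus a `|` K1_plus b)
                            | #|` S| == q]]%fset.

Definition Kq_minus (q a b : nat) : {fset nat} :=
  [fset K in K_products q a b | `[< form_minus K >]]%fset.

Definition Kq_plus (q a b : nat) : {fset nat} :=
  [fset K in K_products q a b | `[< form_plus K >]]%fset.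

(* [Num.truncn] is the nat-valued floor; the arguments below are
   nonnegative whenever [0 < m]. *)
Definition nu (R : realType) (m : nat) : nat :=
  Num.truncn ((1 + Num.sqrt (6 * m%:R + 1)) / 6 : R).

Definition kk (R : realType) (m : nat) : nat :=
  Num.truncn ((- 1 + Num.sqrt (6 * m%:R + 1)) / 6 : R).

Definition rr (R : realType) (m : nat) : nat :=
  Num.truncn (Num.sqrt (6 * m%:R) / 6 : R).

(* [P_plus R m] is P^(+)(6m+1): the argument is m, not 6m+1. *)
Definition P_plus (R : realType) (m : nat) : int :=
  let n := nu R m in
  let k := kk R m in
    \sum_(K <- K1_minus n)
       Num.floor ((6 * m%:R + K%:R + 1) / (6 * K%:R) : R)
  + \sum_(K <- K1_plus k)
       Num.floor ((6 * m%:R - K%:R + 1) / (6 * K%:R) : R)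
  + \sum_(2 <= q < (n + k).+1) (-1) ^+ (q - 1) *
      (  \sum_(K <- Kq_minus q n k)
            Num.floor ((6 * m%:R + K%:R + 1) / (6 * K%:R) : R)
       + \sum_(K <- Kq_plus q n k)
            Num.floor ((6 * m%:R + 5 * K%:R + 1) / (6 * K%:R) : R)).

(* [P_minus R m] is P^(-)(6m-1). The "+ 1" in the [Kq_minus] term is
   intended: for K = -1 mod 6 the floor is the same with "- 1". *)
Definition P_minus (R : realType) (m : nat) : int :=
  let r := rr R m in
    \sum_(K <- K1_minus r)
       Num.floor ((6 * m%:R - K%:R - 1) / (6 * K%:R) : R)
  + \sum_(K <- K1_plus r)
       Num.floor ((6 * m%:R + K%:R - 1) / (6 * K%:R) : R)
  + \sum_(2 <= q < (2 * r).+1) (-1) ^+ (q - 1) *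
      (  \sum_(K <- Kq_minus q r r)
            Num.floor ((6 * m%:R + 5 * K%:R + 1) / (6 * K%:R) : R)
       + \sum_(K <- Kq_plus q r r)
            Num.floor ((6 * m%:R + K%:R - 1) / (6 * K%:R) : R)).

(* Main.v *)
(* A composite number [n <= M] coprime to 6 has a prime factor in the sieving set
   [P = K1_minus a `|` K1_plus b], the primes up to about [sqrt M] other than 2 and 3.
   For each class [e = 1, 5] modulo 6, inclusion-exclusion over the subsets [S] of [P]
   counts the composites in that class, since [S |-> \prod S] is injective. The
   multiples [c * K <= M] of [K = \prod S] in the class [e] are those with [c] in the
   class of [e * K], which gives the floors. They are all composite, except [K] itself
   when [S = [fset K]] and [K] is in the class [e]: whence the different numerators
   for [q = 1]. Each class contains [m] candidates, which leaves [2 * m] minus the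
   composites. *)
Require Import Defs.
From mathcomp Require Import all_boot all_order all_algebra.
From mathcomp Require Import finmap.
From mathcomp Require Import boolp reals.
From mathcomp Require Import zify ring lra.
Import Order.TTheory GRing.Theory Num.Theory.
Local Open Scope ring_scope.

(** * Counting integers and multiples in a residue class modulo 6 *)

Lemma coprime6E K : coprime 6 K = (K %% 6 == 1)%N || (K %% 6 == 5)%N.
Proof.
rewrite -coprime_modr; have := ltn_pmod K (isT : 0 < 6)%N.
by case: (K %% 6)%N; do 6?[case=> //].
Qed.

Lemma count_split (A B C : pred nat) s : (forall n, A n = B n + C n :> nat)%N ->
  (count A s = count B s + count C s)%N.
Proof. by move=> H; elim: s => //= n s ->; rewrite H addnACA. Qed.

Lemma count_eq_iota (K M : nat) (c : bool) : (c -> K <= M)%N ->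
  count (fun n => (n == K) && c) (iota 0 M.+1) = c.
Proof.
case: c => [/(_ isT) KM|_].
  under eq_count do rewrite andbT.
  by rewrite -/(pred1 K) count_uniq_mem ?iota_uniq // mem_iota add0n ltnS KM.
by under eq_count do rewrite andbF; rewrite count_pred0.
Qed.

Lemma card_ord_count (n : nat) (P : pred nat) : #|[set i : 'I_n | P i]| = count P (iota 0 n).
Proof.
by rewrite cardsE -sum1_card -(big_mkord P (fun=> 1%N)) sum1_count /index_iota subn0.
Qed.

Lemma count_iota_geq (n k : nat) (P : pred nat) : (forall i, (n <= i < n + k)%N -> ~~ P i) ->
  count P (iota 0 (n + k)) = count P (iota 0 n).
Proof.
move=> nP; rewrite iotaD count_cat (@eq_in_count _ P pred0 (iota (0 + n) k)).
  by rewrite count_pred0 addn0.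
by move=> i; rewrite mem_iota add0n => /nP /negbTE.
Qed.

(** The class is [e], [e + 6], [e + 12], ...; adding 6 before subtracting [e] keeps the formula
    right under truncated subtraction, also when [x < e]. *)
Lemma count_residue e x : (0 < e < 6)%N ->
  count (fun c => c %% 6 == e)%N (iota 0 x.+1) = ((x + 6 - e) %/ 6)%N.
Proof.
move=> he; elim: x => [|x IH]; first by rewrite /=; lia.
by rewrite -[in LHS](addn1 x.+1) iotaD count_cat IH /= add0n; lia.
Qed.

(** Reindexing by [n = c * K]. In the induction on [M], the quotient [M %/ K] grows exactly when [K]
    divides [M.+1], and then the new [c] satisfies [c * K = M.+1]. *)
Lemma count_multiples (e K M : nat) : (0 < K)%N ->
  count (fun n => (n %% 6 == e) && (K %| n))%N (iota 0 M.+1) =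
  count (fun c => (c * K) %% 6 == e)%N (iota 0 (M %/ K).+1).
Proof.
move=> K0; elim: M => [|M IH]; first by rewrite div0n /= mul0n dvdn0 andbT.
rewrite -[in LHS](addn1 M.+1) iotaD count_cat IH /= add0n divnS //.
have [dK|nK] := boolP (K %| M.+1)%N; last by rewrite andbF !addn0.
rewrite (_ : true + M %/ K = (M %/ K).+1)%N //.
rewrite -[in RHS](addn1 (M %/ K)) iotaD count_cat /= add1n.
by rewrite andbT -[in LHS](divnK dK) divnS // dK add1n !addnA.
Qed.

Lemma count_residue_multiples (e K M : nat) :
    (e < 6)%N -> coprime 6 e -> coprime 6 K ->
  count (fun n => (n %% 6 == e) && (K %| n))%N (iota 0 M.+1) =
  (if K %% 6 == e then (M + 5 * K) %/ (6 * K) else (M + K) %/ (6 * K))%N.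
Proof.
move=> e6 ce cK; have K0 : (0 < K)%N by case: (K) cK.
(* As [K * K] is 1 mod 6, [c * K] is [e] mod 6 iff [c] is [e * K] mod 6. *)
rewrite count_multiples // (mulnC 6%N) !divnMA !(addnC M) divnMDl //.
rewrite -[X in ((X + M) %/ K)%N]mul1n divnMDl //.
move: ce cK; rewrite !coprime6E (modn_small e6) => ce cK.
(* Below, [d] is 1 when [K] is in the class [e], as [e * e] is 1 mod 6, and 5 otherwise, as [K] is
   then [- e] mod 6. *)
have hres d : (forall c, ((c * K) %% 6 == e)%N = (c %% 6 == d)%N) -> (0 < d < 6)%N ->
  count (fun c => (c * K) %% 6 == e)%N (iota 0 (M %/ K).+1) = ((M %/ K + 6 - d) %/ 6)%N.
  by move=> H hd; rewrite -count_residue //; apply: eq_count.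
case: ifP => /eqP KE.
  rewrite (hres 1%N) //; first by rewrite -addnBA // addnC.
  move=> c; rewrite -modnMm KE; have := ltn_pmod c (isT : 0 < 6)%N.
  by case/orP: ce => /eqP ->; case: (c %% 6)%N; do 6?[case=> //].
rewrite (hres 5%N) //; first by rewrite -addnBA // addnC.
move=> c; rewrite -modnMm; have := ltn_pmod c (isT : 0 < 6)%N.
move: ce KE; case/orP: cK => /eqP -> /orP[] /eqP -> //= _;
  by case: (c %% 6)%N; do 6?[case=> //].
Qed.

(** * Products of sets of primes *)

Lemma prod_primes_dvdn (S : {fset nat}) n : {in S, forall p, prime p} ->
  (\prod_(p <- S) p %| n)%N = all (dvdn^~ n) S.
Proof.
move=> Sp; have: uniq S by exact: fset_uniq.
have {Sp}: all prime S by apply/allP.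
elim: (enum_fset S) => [|p s IH] /=; first by rewrite big_nil dvd1n.
case/andP=> pp sp /andP[ps us]; rewrite big_cons Gauss_dvd ?IH //.
rewrite big_seq; apply: (big_ind (coprime p)) => [|x y|q qs].
- exact: coprimen1.
- by rewrite coprimeMr => -> ->.
rewrite prime_coprime // dvdn_prime2 //; last exact: (allP sp).
by apply: contraNneq ps => ->.
Qed.

Lemma prod_primes_gt0 (S : {fset nat}) : {in S, forall p, prime p} ->
  (0 < \prod_(p <- S) p)%N.
Proof.
move=> Sp; rewrite big_seq.
apply: (big_ind (fun x => 0 < x)%N) => // [x y|p /Sp/prime_gt0 //].
by rewrite muln_gt0 => -> ->.
Qed.

(** Two different elements [p] and [q] can be taken out of [S], so [p] is a divisor of the product
    other than 1 and the product itself. *)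
Lemma prod_primes_composite (S : {fset nat}) : {in S, forall p, prime p} ->
  (1 < #|` S|)%N -> (1 < \prod_(p <- S) p)%N /\ ~~ prime (\prod_(p <- S) p).
Proof.
move=> Sp S1; have /fset0Pn[p pS] : S != fset0 by rewrite -cardfs_gt0 ltnW.
have /fset0Pn[q qS] : (S `\ p)%fset != fset0.
  by rewrite -cardfs_gt0; move: S1; rewrite (cardfsD1 p) pS.
rewrite (big_fsetD1 p) //= (big_fsetD1 q) //=.
have q1 : (1 < q)%N by apply/prime_gt1/Sp; move: qS; rewrite !inE => /andP[].
have p1 := prime_gt1 (Sp _ pS).
have Q0 : (0 < \prod_(r <- ((S `\ p) `\ q)%fset) r)%N.
  by apply: prod_primes_gt0 => r; rewrite !inE => /and3P[_ _ /Sp].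
set Q := (q * _)%N; have: (1 < Q)%N by rewrite (leq_trans q1) // leq_pmulr.
move: Q => Q Q1.
split; first by nia.
apply/negP => /primeP[_ /(_ p (dvdn_mulr _ (dvdnn _)))].
by case/orP => /eqP; nia.
Qed.

(** A prime dividing a product of primes is one of the factors, so the product determines its set of
    factors. *)
Lemma prod_primes_inj (P : {fset nat}) : {in P, forall p, prime p} ->
  {in fpowerset P &, injective (fun S : {fset nat} => \prod_(p <- S) p)%N}.
Proof.
move=> Pp.
have sub (S T : {fset nat}) : (S `<=` P)%fset -> (T `<=` P)%fset ->
    (\prod_(p <- S) p = \prod_(p <- T) p)%N -> (S `<=` T)%fset.
  move=> /fsubsetP SP /fsubsetP TP eST; apply/fsubsetP => p pS.
  have pp := Pp p (SP p pS).
  have: (p %| \prod_(q <- T) q)%N.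
    by rewrite -eST (big_fsetD1 p) //= dvdn_mulr.
  rewrite big_seq; elim/big_ind : _ => [|x y IHx IHy|q qT].
  - by rewrite dvdn1 => /eqP p1; rewrite p1 in pp.
  - by rewrite Euclid_dvdM // => /orP[].
  - by rewrite dvdn_prime2 ?(Pp _ (TP _ qT)) // => /eqP ->.
move=> S T; rewrite !fpowersetE => SP TP eST.
apply/eqP; rewrite eqEfsubset; apply/andP; split; first exact: sub eST.
exact: sub (esym eST).
Qed.

(** * Inclusion-exclusion over the subsets of a set of primes *)

Lemma sum_fpowerset_prod (R : comPzRingType) (T : choiceType) (P : {fset T}) (f : T -> R) :
  \sum_(S <- fpowerset P) \prod_(p <- S) f p = \prod_(p <- P) (1 + f p).
Proof.
rewrite [RHS]big_seq_fsetE /=.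
under [RHS]eq_bigr do rewrite addrC.
rewrite bigA_distr /fpowerset big_imfset /=; last first.
  by move=> X Y _ _ /fsetP eqXY; apply/setP => x; have := eqXY (val x); rewrite !inE.
rewrite big_enum /=; apply: eq_big => [Y|Y _]; first by rewrite powersetE subsetT.
rewrite big_imfset /=; last by move=> x y _ _; exact: val_inj.
by rewrite big_enum /= [LHS]big_mkcond.
Qed.

(** The product of [1 - [p | n]] over [P] vanishes exactly when some [p] divides [n]. Expanding it
    over subsets, the term of [fset0] is the 1 that cancels. *)
Lemma has_dvdn_alternating (P : {fset nat}) n : {in P, forall p, prime p} ->
  (has (dvdn^~ n) P)%:Z =
  \sum_(S <- fpowerset P | S != fset0)
     (-1) ^+ (#|` S| - 1) * (\prod_(p <- S) p %| n)%N%:Z.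
Proof.
move=> Pp; have := sum_fpowerset_prod int nat P (fun p => - (p %| n)%N%:Z).
rewrite (bigD1_seq fset0) ?fset_uniq ?fpowersetE ?fsub0set //= big_seq_fset0.
have -> : \prod_(p <- P) (1 - (p %| n)%N%:Z) = 1 - (has (dvdn^~ n) P)%:Z.
  elim: (enum_fset P) => [|p s IH]; first by rewrite big_nil.
  by rewrite big_cons IH /=; case: (p %| n)%N; rewrite /= ?(subrr, mul0r, subr0, mul1r).
move=> /addrI /esym /(canRL (@opprK _)) ->.
rewrite -sumrN big_seq_cond [RHS]big_seq_cond; apply: eq_bigr => S.
rewrite fpowersetE => /andP[/fsubsetP SP S0].
rewrite prod_primes_dvdn => [|p /SP /Pp //].
have -> : \prod_(p <- S) - (p %| n)%N%:Z = (-1) ^+ #|` S| * (all (dvdn^~ n) S)%:Z :> int.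
  elim: (enum_fset S) => [|p s IH]; first by rewrite big_nil.
  rewrite big_cons IH /= exprS; case: (p %| n)%N;
    by rewrite /= ?(mul0r, mulr0, mulN1r, mulNr, mul1r, oppr0).
by rewrite -[#|` S|]prednK ?cardfs_gt0 // subn1 /= exprS mulN1r mulNr opprK.
Qed.

(** Summation over [s], with the subsets grouped by size. [N] may exceed the size of [P], since the
    larger sizes give empty sums; the explicit formulas need this, as their range of [q] counts
    candidates and not primes. *)
Lemma count_has_dvdn (P : {fset nat}) (s : seq nat) N :
    {in P, forall p, prime p} -> (#|` P| <= N)%N ->
  (count (fun n => has (dvdn^~ n) P) s)%:Z =
  \sum_(1 <= q < N.+1) (-1) ^+ (q - 1) *
     \sum_(S <- fpowerset P | #|` S| == q) (count (dvdn (\prod_(p <- S) p)%N) s)%:Z.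
Proof.
move=> Pp PN; have countZ (a : pred nat) : (count a s)%:Z = \sum_(n <- s) (a n)%:Z.
  by elim: s => [|n s IH] /=; rewrite ?big_nil // big_cons -IH.
rewrite countZ; under eq_bigr do rewrite has_dvdn_alternating //.
rewrite [LHS]exchange_big /=.
under [RHS]eq_bigr do rewrite big_distrr /= big_mkcond.
rewrite [RHS]exchange_big /= big_mkcond /= big_seq [RHS]big_seq.
apply: eq_bigr => S; rewrite fpowersetE => SP.
have [->|S0] /= := eqVneq S fset0.
  by rewrite big_nat big1 // => - [].
have SN : #|` S| \in index_iota 1 N.+1.
  by rewrite mem_index_iota cardfs_gt0 S0 ltnS (leq_trans _ PN) // fsubset_leq_card.
rewrite (bigD1_seq _ SN) ?iota_uniq //=.
rewrite eqxx [X in _ + X]big1 => [|q]; last by rewrite eq_sym => /negbTE ->.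
by rewrite addr0 countZ mulr_sumr.
Qed.

(** * Arithmetic of the sieving set and of its products *)

Lemma form_minusE n : `[< form_minus n >] = (n %% 6 == 5)%N.
Proof.
apply/asboolP/eqP => [[t t0 ->]|n5]; first by lia.
by exists (n %/ 6).+1 => //; lia.
Qed.

(** The bound [1 < n] excludes 1, which would require [tau = 0]. *)
Lemma form_plusE n : `[< form_plus n >] = (1 < n)%N && (n %% 6 == 1)%N.
Proof.
apply/asboolP/andP => [[t t0 ->]|[n1 /eqP n6]]; first by split; lia.
by exists (n %/ 6)%N; lia.
Qed.

(** For [a = 0] the truncated bound is 0, which no prime satisfies, so the empty case is covered. *)
Lemma in_K1_minus a p :
  (p \in K1_minus a) = [&& prime p, p %% 6 == 5 & p <= 6 * a - 1]%N.
Proof.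
rewrite /K1_minus !inE /= andbC; case: (prime p) => //=.
apply/mapP/andP => [[i]|[/eqP p5 pa]]; first by rewrite mem_iota => hi ->; split; lia.
by exists (p %/ 6).+1; rewrite ?mem_iota; lia.
Qed.

Lemma in_K1_plus b p :
  (p \in K1_plus b) = [&& prime p, p %% 6 == 1 & p <= 6 * b + 1]%N.
Proof.
rewrite /K1_plus !inE /= andbC; case: (boolP (prime p)) => //= /prime_gt1 p1.
apply/mapP/andP => [[i]|[/eqP p5 pa]]; first by rewrite mem_iota => hi ->; split; lia.
by exists (p %/ 6)%N; rewrite ?mem_iota; lia.
Qed.

Lemma sieving_prime a b p : p \in (K1_minus a `|` K1_plus b)%fset -> prime p.
Proof. by rewrite inE in_K1_minus in_K1_plus => /orP[] /and3P[]. Qed.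

Lemma sieving_coprime6 a b p : p \in (K1_minus a `|` K1_plus b)%fset -> coprime 6 p.
Proof.
by rewrite inE in_K1_minus in_K1_plus coprime6E => /orP[] /and3P[_ -> _]; rewrite ?orbT.
Qed.

Lemma card_sieving a b : (#|` (K1_minus a `|` K1_plus b)%fset| <= a + b)%N.
Proof.
pose s := [seq (6 * i - 1)%N | i <- iota 1 a] ++ [seq (6 * j + 1)%N | j <- iota 1 b].
have -> : (a + b)%N = size s by rewrite size_cat !size_map !size_iota.
apply: uniq_leq_size (fset_uniq _) _ => p.
by rewrite /s !inE mem_cat => /orP[] /andP[-> _]; rewrite ?orbT.
Qed.

Lemma prod_coprime6 a b (S : {fset nat}) : (S `<=` K1_minus a `|` K1_plus b)%fset ->
  coprime 6 (\prod_(p <- S) p).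
Proof.
move=> /fsubsetP SP; rewrite big_seq; apply: (big_ind (coprime 6)) => //.
  by move=> x y; rewrite coprimeMr => -> ->.
by move=> p /SP; exact: sieving_coprime6.
Qed.

Lemma sum_K_products a b q (F : nat -> int) :
  \sum_(K <- K_products q a b) F K =
  \sum_(S <- fpowerset (K1_minus a `|` K1_plus b)%fset | #|` S| == q) F (\prod_(p <- S) p)%N.
Proof.
rewrite /K_products big_imfset /=; last first.
  move=> S T; rewrite !inE /= => /andP[SP _] /andP[TP _].
  by apply: prod_primes_inj SP TP; exact: sieving_prime.
by rewrite big_fset.
Qed.

(** * Sieve formula for the composites of one residue class *)

Definition composite_mod6 (e n : nat) := [&& n %% 6 == e, 1 < n & ~~ prime n]%N.

(** The correction term stands for [K] itself, the only multiple of [K] in the class that can be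
    prime; [prime K -> K <= M] puts it in the counted range. *)
Lemma count_composite_multiples (e K M : nat) :
    (e < 6)%N -> coprime 6 e -> coprime 6 K -> (1 < K)%N -> (prime K -> K <= M)%N ->
  (count (fun n => composite_mod6 e n && (K %| n)) (iota 0 M.+1)
     + (prime K && (K %% 6 == e)))%N =
  (if K %% 6 == e then (M + 5 * K) %/ (6 * K) else (M + K) %/ (6 * K))%N.
Proof.
move=> e6 ce cK K1 KM; rewrite -count_residue_multiples //.
rewrite -[X in (_ + X)%N](count_eq_iota K M) => [|/andP[/KM] //].
symmetry; apply: count_split => n; rewrite /composite_mod6.
have [->|nK] := eqVneq n K.
  by rewrite dvdnn K1 /= !andbT andbC; case: (prime K); case: (_ == e).
rewrite addn0; case: eqP => [ne|] //=; have [Kn|] := boolP (K %| n)%N; last by rewrite !andbF.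
rewrite !andbT; have n1 : (1 < n)%N.
  (* The value 0 is ruled out because [e] is coprime to 6, and 1 because [K] divides [n]. *)
  case: n {nK} ne Kn => [|[|n]] //; first by move=> e0; rewrite -e0 in ce.
  by rewrite dvdn1 => _ /eqP KE; rewrite KE in K1.
rewrite n1 /=; case: (boolP (prime n)) => // /primeP[_ /(_ _ Kn)].
by rewrite (gtn_eqF K1) eq_sym (negbTE nK).
Qed.

Lemma count_composite_mod6 (e M a b : nat) (P := (K1_minus a `|` K1_plus b)%fset) :
    (e < 6)%N -> coprime 6 e -> {in P, forall p, p <= M}%N ->
    (forall n, (n <= M)%N -> composite_mod6 e n -> has (dvdn^~ n) P) ->
  (count (composite_mod6 e) (iota 0 M.+1))%:Z =
  \sum_(p <- P)
     (if p %% 6 == e then (M - p) %/ (6 * p) else (M + p) %/ (6 * p))%N%:Z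
  + \sum_(2 <= q < (a + b).+1) (-1) ^+ (q - 1) *
     \sum_(K <- K_products q a b)
       (if K %% 6 == e then (M + 5 * K) %/ (6 * K) else (M + K) %/ (6 * K))%N%:Z.
Proof.
move=> e6 ce PM hasP; pose s := filter (composite_mod6 e) (iota 0 M.+1).
have -> : count (composite_mod6 e) (iota 0 M.+1) = count (fun n => has (dvdn^~ n) P) s.
  rewrite count_filter; apply: eq_in_count => n; rewrite mem_iota add0n ltnS => nM /=.
  by case: (boolP (composite_mod6 e n)) => [/hasP-> //|]; rewrite andbF.
have cs K : count (dvdn K) s = count (fun n => composite_mod6 e n && (K %| n)%N) (iota 0 M.+1).
  by rewrite count_filter; apply: eq_count => n /=; rewrite andbC.
have Pp : {in P, forall p, prime p} by exact: sieving_prime.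
(* When [a + b = 0] there is no term [q = 1] to split off, and [P] is empty. *)
have [ab0|ab0] := posnP (a + b).
  have P0 : P = fset0 by apply/eqP; rewrite -cardfs_eq0 -leqn0 -ab0 card_sieving.
  by rewrite ab0 big_geq // addr0 P0 big_seq_fset0 (@eq_count _ _ pred0) ?count_pred0.
rewrite (count_has_dvdn P s (a + b)) ?card_sieving //.
rewrite big_ltn // expr0 mul1r.
rewrite -(sum_K_products a b 1 (fun K => (count (dvdn K) s)%:Z)); congr (_ + _).
  have -> : K_products 1 a b = P.
    apply/fsetP => K; apply/imfsetP/idP => /= [[S hS ->]|KP].
      rewrite !inE /= fpowersetE in hS; case/andP: hS => /fsubsetP SP /cardfs1P[p Sp].
      by rewrite {S}Sp in SP *; rewrite big_seq_fset1; apply: SP; rewrite inE.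
    by exists [fset K]%fset; rewrite ?big_seq_fset1 // !inE /= fpowersetE fsub1set KP cardfs1.
  rewrite big_seq [RHS]big_seq; apply: eq_bigr => p pP; rewrite cs.
  have p1 := prime_gt1 (Pp p pP); have pM := PM p pP.
  have /eqP := count_composite_multiples e p M e6 ce (sieving_coprime6 _ _ _ pP) p1 (fun=> pM).
  rewrite Pp //=; case: ifP => _ /eqP; last by rewrite addn0 => ->.
  (* Discarding the prime [p] lowers the quotient by one, which turns the numerator [M + 5 * p] into
     [M - p]; this uses [p <= M]. *)
  have -> : (M + 5 * p = 1 * (6 * p) + (M - p))%N by lia.
  by rewrite divnMDl ?muln_gt0 ?(ltnW p1) // addnC => /addnI ->.
rewrite big_nat_cond [RHS]big_nat_cond; apply: eq_bigr => q /andP[/andP[q2 _] _].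
congr (_ * _); rewrite sum_K_products big_seq_cond [RHS]big_seq_cond.
apply: eq_bigr => S /andP[]; rewrite fpowersetE => SP /eqP Sq.
have Sp : {in S, forall p, prime p} by move=> p /(fsubsetP SP)/Pp.
have [K1 Kp] : (1 < \prod_(p <- S) p)%N /\ ~~ prime (\prod_(p <- S) p).
  by apply: prod_primes_composite; rewrite // Sq.
rewrite cs -(count_composite_multiples e _ M) ?(negbTE Kp) ?addn0 //.
exact: prod_coprime6 SP.
Qed.

Lemma sum_disjoint_fsetU (A B C : {fset nat}) (F : nat -> int) :
  (forall x, (x \in C) = (x \in A) || (x \in B)) -> (forall x, x \in A -> x \notin B) ->
  \sum_(x <- C) F x = \sum_(x <- A) F x + \sum_(x <- B) F x.
Proof.
move=> CAB dAB; rewrite -big_cat /=; apply: perm_big; apply: uniq_perm.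
- exact: fset_uniq.
- rewrite cat_uniq !fset_uniq andbT /=; apply/hasPn => x xB.
  by apply: contraL xB; exact: dAB.
by move=> x; rewrite mem_cat CAB.
Qed.

Lemma sum_sieving_primes a b (F : nat -> int) :
  \sum_(p <- (K1_minus a `|` K1_plus b)%fset) F p =
  \sum_(p <- K1_minus a) F p + \sum_(p <- K1_plus b) F p.
Proof.
apply: sum_disjoint_fsetU => p; first by rewrite inE.
by rewrite in_K1_minus in_K1_plus => /and3P[_ /eqP -> _]; rewrite andbF.
Qed.

(** A product coprime to 6 and greater than 1 has exactly one of the two forms. The bound on [q]
    keeps out the empty product 1, which has neither. *)
Lemma sum_K_products_classes q a b (F : nat -> int) : (1 < q)%N ->
  \sum_(K <- K_products q a b) F K =
  \sum_(K <- Kq_minus q a b) F K + \sum_(K <- Kq_plus q a b) F K.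
Proof.
move=> q1; apply: sum_disjoint_fsetU => K; rewrite !inE /= form_minusE form_plusE; last first.
  by move=> /andP[_ /eqP ->]; rewrite !andbF.
rewrite -andb_orr; case: (boolP (K \in _)) => //= /imfsetP[/= S].
rewrite !inE fpowersetE => /andP[SP /eqP Sq] ->.
rewrite -Sq in q1.
have Sp : {in S, forall p, prime p} by move=> p /(fsubsetP SP); exact: sieving_prime.
have [-> _] := prod_primes_composite S Sp q1.
by have := prod_coprime6 _ _ _ SP; rewrite coprime6E orbC.
Qed.

(** * Integer forms of the floors and of the square-root bounds *)

Lemma floor_divn (R : realType) (x : R) (k d : nat) :
  (0 < d)%N -> x = k%:R / d%:R -> Num.floor x = (k %/ d)%N%:Z.
Proof.
move=> d0 ->; apply: floor_def; have dR : 0 < d%:R :> R by rewrite ltr0n.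
rewrite ler_pdivlMr // ltr_pdivrMr // -PoszD -!pmulrn -!natrM ler_nat ltr_nat addn1.
by rewrite leq_divM /= -ltn_divLR.
Qed.

Lemma ler_sqrt_nat (R : realType) (c n : nat) :
  (c%:R <= Num.sqrt n%:R :> R) = (c ^ 2 <= n)%N.
Proof.
rewrite -(ger0_norm (ler0n R c)) -sqrtr_sqr ler_sqrt ?ler0n //.
by rewrite -natrX ler_nat.
Qed.

(** With [t = i + 1], the condition [t <= (1 + sqrt (6 m + 1)) / 6] says that [6 t - 1 = 6 i + 5] is
    at most the square root. In the same way [kk] bounds [6 t + 1 = 6 j + 7] with [t = j + 1], and
    [rr] bounds [6 t]. *)
Lemma nuE (R : realType) m i : (i < nu R m)%N = ((6 * i + 5) ^ 2 <= 6 * m + 1)%N.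
Proof.
rewrite truncn_gt_nat -(ler_sqrt_nat R) !(natrD, natrM) -addn1 natrD.
by apply/idP/idP; lra.
Qed.

Lemma kkE (R : realType) m j : (j < kk R m)%N = ((6 * j + 7) ^ 2 <= 6 * m + 1)%N.
Proof.
rewrite truncn_gt_nat -(ler_sqrt_nat R) !(natrD, natrM) -addn1 natrD.
by apply/idP/idP; lra.
Qed.

Lemma rrE (R : realType) m i : (i < rr R m)%N = (6 * i.+1 ^ 2 <= m)%N.
Proof.
rewrite truncn_gt_nat -(leq_pmul2l (isT : 0 < 6)%N) mulnA -[(6 * 6)%N]/(6 ^ 2)%N -expnMn.
rewrite -(ler_sqrt_nat R) !natrM.
by apply/idP/idP; lra.
Qed.

(** [p] is the least prime factor. The cofactor [c] is kept because its residue gives more than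
    [p * p <= n] in the class 5. *)
Lemma composite_min_factor n : coprime 6 n -> (1 < n)%N -> ~~ prime n ->
  exists p c, [/\ prime p, n = (c * p)%N, (p <= c)%N & (p %% 6 == 1)%N || (p %% 6 == 5)%N].
Proof.
move=> cn n1 np; exists (pdiv n), (n %/ pdiv n)%N; split.
- exact: pdiv_prime.
- by rewrite divnK ?pdiv_dvd.
- rewrite leq_divRL ?pdiv_gt0 // leqNgt mulnn.
  by apply: contra np; apply: ltn_pdiv2_prime; exact: ltnW.
- by rewrite -coprime6E (coprime_dvdr (pdiv_dvd n)).
Qed.

(** * The explicit formulas count the composites of each class *)

Lemma P_plusE (R : realType) (m : nat) :
  P_plus R m = (count (composite_mod6 1) (iota 0 (6 * m + 1).+1))%:Z.
Proof.
rewrite /P_plus; set a := nu R m; set b := kk R m.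
have aP i : (i < a)%N = ((6 * i + 5) ^ 2 <= 6 * m + 1)%N by exact: nuE.
have bP i : (i < b)%N = ((6 * i + 7) ^ 2 <= 6 * m + 1)%N by exact: kkE.
(* If [a > 0], the square of [6 * a - 1] is at most [6 * m + 1] by [aP] at [a - 1]; hence so is
   every [p] in [K1_minus a]. *)
have pa p : p \in K1_minus a -> [/\ (0 < p), p %% 6 = 5 & p <= 6 * m + 1]%N.
  rewrite in_K1_minus => /and3P[/prime_gt0 p0 /eqP p5 pa]; split=> //.
  case: (a) aP pa => [|c] cP pc; first by lia.
  by have := cP c; rewrite ltnSn => /esym; nia.
have pb p : p \in K1_plus b -> [/\ (0 < p), p %% 6 = 1 & p <= 6 * m + 1]%N.
  rewrite in_K1_plus => /and3P[/prime_gt1 p0 /eqP p5 pb]; split=> //; first by lia.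
  case: (b) bP pb => [|c] cP pc; first by lia.
  by have := cP c; rewrite ltnSn => /esym; nia.
rewrite (count_composite_mod6 1 (6 * m + 1) a b) //; first last.
- move=> n nM /and3P[/eqP n1 gt1 np].
  have cn : coprime 6 n by rewrite coprime6E n1.
  have [p [c [pp nE pc p6]]] := composite_min_factor n cn gt1 np; apply/hasP.
  exists p; last by rewrite nE dvdn_mull.
  have pM : (p * p <= 6 * m + 1)%N by rewrite (leq_trans _ nM) // nE leq_mul2r pc orbT.
  rewrite inE in_K1_minus in_K1_plus pp /=; have p1 := prime_gt1 pp.
  case/orP: p6 => /eqP p6; rewrite p6 /=.
    (* The number [6 * i + 7] is [6 * tau + 1] for [tau = i + 1], so [bP] turns the bound on its
       square into [tau <= b]. *)
    have [i pE] : exists i, p = (6 * i + 7)%N by exists (p %/ 6).-1; lia.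
    have : ((6 * i + 7) ^ 2 <= 6 * m + 1)%N by rewrite -mulnn -pE.
    by rewrite -bP; lia.
  have [i pE] : exists i, p = (6 * i + 5)%N by exists (p %/ 6)%N; lia.
  have : ((6 * i + 5) ^ 2 <= 6 * m + 1)%N by rewrite -mulnn -pE.
  by rewrite -aP; lia.
- by move=> p; rewrite inE => /orP[/pa[]|/pb[]].
rewrite sum_sieving_primes; congr (_ + _ + _).
- rewrite big_seq [RHS]big_seq; apply: eq_bigr => p /pa[p0 p5 pM].
  rewrite p5 /=; apply: floor_divn; rewrite ?muln_gt0 // !(natrD, natrM).
  by congr (_ / _); ring.
- rewrite big_seq [RHS]big_seq; apply: eq_bigr => p /pb[p0 p1 pM].
  rewrite p1 /=; apply: floor_divn; rewrite ?muln_gt0 // natrB // !(natrD, natrM).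
  by congr (_ / _); ring.
rewrite big_nat_cond [RHS]big_nat_cond; apply: eq_bigr => q /andP[/andP[q2 _] _].
rewrite sum_K_products_classes //; congr (_ * (_ + _)).
- rewrite big_seq [RHS]big_seq; apply: eq_bigr => K.
  rewrite !inE /= form_minusE => /andP[_ /eqP K5].
  rewrite K5 /=; apply: floor_divn; first by lia.
  by rewrite !(natrD, natrM); congr (_ / _); ring.
rewrite big_seq [RHS]big_seq; apply: eq_bigr => K.
rewrite !inE /= form_plusE => /and3P[_ K0 /eqP K1].
rewrite K1 /=; apply: floor_divn; first by lia.
by rewrite !(natrD, natrM); congr (_ / _); ring.
Qed.

Lemma P_minusE (R : realType) (m : nat) : (0 < m)%N ->
  P_minus R m = (count (composite_mod6 5) (iota 0 (6 * m - 1).+1))%:Z.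
Proof.
move=> m0; rewrite /P_minus; set r := rr R m.
have rP i : (i < r)%N = (6 * i.+1 ^ 2 <= m)%N by exact: rrE.
have pa p : p \in K1_minus r -> [/\ (0 < p), p %% 6 = 5 & p <= 6 * m - 1]%N.
  rewrite in_K1_minus => /and3P[/prime_gt0 p0 /eqP p5 pa]; split=> //.
  case: (r) rP pa => [|c] cP pc; first by lia.
  by have := cP c; rewrite ltnSn => /esym; nia.
have pb p : p \in K1_plus r -> [/\ (0 < p), p %% 6 = 1 & p <= 6 * m - 1]%N.
  rewrite in_K1_plus => /and3P[/prime_gt1 p0 /eqP p5 pb]; split=> //; first by lia.
  case: (r) rP pb => [|c] cP pc; first by lia.
  by have := cP c; rewrite ltnSn => /esym; nia.
have natM : (6 * m - 1)%:R = 6 * m%:R - 1 :> R by rewrite natrB ?natrM ?muln_gt0.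
rewrite (count_composite_mod6 5 (6 * m - 1) r r) //; first last.
- move=> n nM /and3P[/eqP n5 gt1 np].
  have cn : coprime 6 n by rewrite coprime6E n5.
  have [p [c [pp nE pc p6]]] := composite_min_factor n cn gt1 np; apply/hasP.
  exists p; last by rewrite nE dvdn_mull.
  rewrite inE in_K1_minus in_K1_plus pp /=; have p1 := prime_gt1 pp.
  (* Since the product is 5 mod 6, one of [c] and [p] is 1 and the other 5 mod 6. They differ, so
     [p <= c] sharpens to [c >= 6 * i + 7] even when [p = 6 * i + 5]. *)
  have c6 : (((c %% 6) * (p %% 6)) %% 6 = 5)%N by rewrite modnMm -nE.
  case/orP: p6 => /eqP p6; rewrite p6 /= in c6 *.
    have [i pE] : exists i, p = (6 * i + 7)%N by exists (p %/ 6).-1; lia.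
    have : ((6 * i + 7) * p <= 6 * m - 1)%N
    by rewrite (leq_trans _ nM) // nE leq_mul2r; lia.
    rewrite pE => ipM; have : (6 * i.+1 ^ 2 <= m)%N by rewrite -mulnn; lia.
    by rewrite -rP; lia.
  have [i pE] : exists i, p = (6 * i + 5)%N by exists (p %/ 6)%N; lia.
  have : ((6 * i + 7) * p <= 6 * m - 1)%N
    by rewrite (leq_trans _ nM) // nE leq_mul2r; lia.
  (* As [(6 i + 7) (6 i + 5) = 36 (i + 1)^2 - 1], the bound by [6 m - 1] is exactly
     [6 (i + 1)^2 <= m], which explains the cutoff [r]. *)
  rewrite pE => ipM; have : (6 * i.+1 ^ 2 <= m)%N by rewrite -mulnn; lia.
  by rewrite -rP; lia.
- by move=> p; rewrite inE => /orP[/pa[]|/pb[]].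
rewrite sum_sieving_primes addnn -mul2n; congr (_ + _ + _).
- rewrite big_seq [RHS]big_seq; apply: eq_bigr => p /pa[p0 p5 pM].
  rewrite p5 /=; apply: floor_divn; rewrite ?muln_gt0 // natrB // natM !(natrD, natrM).
  by congr (_ / _); ring.
- rewrite big_seq [RHS]big_seq; apply: eq_bigr => p /pb[p0 p1 pM].
  rewrite p1 /=; apply: floor_divn; rewrite ?muln_gt0 // natrD natM !natrM.
  by congr (_ / _); ring.
rewrite big_nat_cond [RHS]big_nat_cond; apply: eq_bigr => q /andP[/andP[q2 _] _].
rewrite sum_K_products_classes //; congr (_ * (_ + _)).
- rewrite big_seq [RHS]big_seq; apply: eq_bigr => K.
  rewrite !inE /= form_minusE => /andP[_ /eqP K5].
  rewrite K5 /=; have K0 : (0 < 6 * K)%N by lia.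
  (* The numerator in the definition is [M + 5 * K + 2] with [M = 6 * m - 1]; as
     [M + 5 * K] is 0 mod 6, the extra 2 does not change the floor. *)
  transitivity (((6 * m + 5 * K + 1) %/ (6 * K))%N%:Z).
    by apply: floor_divn; rewrite // !(natrD, natrM).
  have -> : (6 * m + 5 * K + 1 = (6 * m - 1 + 5 * K) + 2)%N by lia.
  have [t tE] : exists t, (6 * m - 1 + 5 * K = 6 * t)%N.
    by exists ((6 * m - 1 + 5 * K) %/ 6)%N; lia.
  by rewrite tE !divnMA -[LHS]/((_ %/ K)%N%:Z); congr (_ %/ K)%N%:Z; lia.
rewrite big_seq [RHS]big_seq; apply: eq_bigr => K.
rewrite !inE /= form_plusE => /and3P[_ K0 /eqP K1].
rewrite K1 /=; apply: floor_divn; first by lia.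
by rewrite natrD natM !natrM; congr (_ / _); ring.
Qed.

(** * Counting primes by complement in each class *)

Lemma prime_pi_plusE x :
  prime_pi_plus x = count (fun n => prime n && (n %% 6 == 1)%N) (iota 0 x.+1).
Proof.
rewrite -card_ord_count; apply: eq_card => p; rewrite !inE form_plusE.
by have [/prime_gt1 ->|] := boolP (prime p).
Qed.

Lemma prime_pi_minusE x :
  prime_pi_minus x = count (fun n => prime n && (n %% 6 == 5)%N) (iota 0 x.+1).
Proof.
by rewrite -card_ord_count; apply: eq_card => p; rewrite !inE form_minusE.
Qed.

Lemma count_class_primes (e s : nat) :
  (count (fun n => (1 < n) && (n %% 6 == e)) (iota 0 s) =
   count (fun n => prime n && (n %% 6 == e)) (iota 0 s)
     + count (composite_mod6 e) (iota 0 s))%N.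
Proof.
apply: count_split => n; rewrite /composite_mod6.
have [/prime_gt1 ->|_] := boolP (prime n); rewrite ?andbF ?addn0 //=.
by rewrite andbT add0n andbC.
Qed.

Lemma prime_mod6 p : prime p -> p != 2 -> p != 3 -> (p %% 6 == 1)%N || (p %% 6 == 5)%N.
Proof.
move=> pp p2 p3; rewrite -coprime6E -[6%N]/(2 * 3)%N coprimeMl !prime_coprime //.
by rewrite !dvdn_prime2 // ![_ == p]eq_sym p2.
Qed.

Lemma prime_pi_split m : (0 < m)%N ->
  prime_pi (6 * m + 1) = (prime_pi_plus (6 * m + 1) + prime_pi_minus (6 * m - 1))%N.
Proof.
move=> m0; rewrite prime_pi_plusE prime_pi_minusE /prime_pi.
rewrite (card_ord_count _ (fun p => [&& prime p, p != 2 & p != 3])).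
have -> : ((6 * m - 1).+1 = 6 * m)%N by lia.
(* Neither [6 * m] nor [6 * m + 1] is 5 mod 6, so both classes can be counted over the same
   range. *)
rewrite -[in RHS](count_iota_geq (6 * m) 2) => [|i hi]; last first.
  by rewrite negb_and; apply/orP; right; lia.
have -> : ((6 * m + 1).+1 = 6 * m + 2)%N by lia.
apply: count_split => p; case: (boolP (prime p)) => //= pp.
have [->|p2] := eqVneq p 2%N; first by [].
have [->|p3] := eqVneq p 3%N; first by [].
by have /orP[/eqP->|/eqP->] := prime_mod6 p pp p2 p3.
Qed.

Theorem theorem4 (R : realType) (m : nat) (m_gt0 : (0 < m)%N) :
  prime_pi (6 * m + 1)%N =
    (prime_pi_plus (6 * m + 1) + prime_pi_minus (6 * m - 1))%N
  /\ (prime_pi (6 * m + 1)%N)%:Z = (2 * m)%N%:Z - (P_plus R m + P_minus R m).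
Proof.
split; first exact: prime_pi_split.
rewrite prime_pi_split // P_plusE P_minusE //.
have := count_class_primes 1 (6 * m + 1).+1.
have := count_class_primes 5 (6 * m - 1).+1.
rewrite -prime_pi_plusE -prime_pi_minusE.
have -> : count (fun n => (1 < n) && (n %% 6 == 5))%N (iota 0 (6 * m - 1).+1) = m.
  rewrite (@eq_count _ _ (fun n => n %% 6 == 5)%N) ?count_residue //; first by lia.
  by case=> [|[]].
(* Up to [6 * m + 1] the class 1 has [m + 1] elements; removing 1 leaves [m]. *)
have -> : count (fun n => (1 < n) && (n %% 6 == 1))%N (iota 0 (6 * m + 1).+1) = m.
  have := count_split (fun n => n %% 6 == 1)%N (fun n => (1 < n) && (n %% 6 == 1))%N
            (fun n => (n == 1) && true)%N (iota 0 (6 * m + 1).+1).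
  rewrite count_residue // count_eq_iota => [H|_]; last by rewrite addn1.
  have : forall n, (n %% 6 == 1 = ((1 < n) && (n %% 6 == 1)) + ((n == 1) && true) :> nat)%N.
    by case=> [|[|n]] //=; rewrite addn0.
  by move=> /H; lia.
lia.
Qed.
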